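(* Let $p$ be a prime and let $\beta\in\mathbb{Q}_p$ with $|\beta|_p>1$. Let $S$ be an infinite set of positive integers such that $1\in S$. If $S\subset\mathrm{Per}(\beta)$, then $\beta$ is a Pisot-Chabauty number or a Salem-Chabauty number.
   Context: Let $p$ be a prime, $\mathbb{Z}_p\subset\mathbb{Q}_p$ the $p$-adic integers and $p$-adic numbers, $|\cdot|_p$ the $p$-adic absolute value with $|p|_p=p^{-1}$, extended uniquely to algebraic extensions of $\mathbb{Q}_p$, and $|\cdot|_\infty$ the usual absolute value on $\mathbb{C}$. Put $\mathbb{A}_p:=\mathbb{Z}[\tfrac1p]=\{mp^n:m,n\in\mathbb{Z}\}\subset\mathbb{Q}\subset\mathbb{Q}_p$. Algebraic integers over $\mathbb{A}_p$: an element $\alpha$ is an algebraic integer over $\mathbb{A}_p$ if it is a root of a monic polynomial irreducible over $\mathbb{A}_p$ with coefficients in $\mathbb{A}_p$, called its minimal polynomial. If $n$ is its degree, the non-archimedean conjugates $\alpha_1=\alpha,\alpha_2,\dots,\alpha_n$ of $\alpha$ are the roots of the minimal polynomial in an algebraic closure of $\mathbb{Q}_p$, and the archimedean conjugates $\alpha_{n+1},\dots,\alpha_{2n}$ are its roots in $\mathbb{C}$. Pisot-Chabauty (PC) number: a number $\alpha\in\mathbb{Q}_p$ such that (i) $\alpha_1:=\alpha$ is an algebraic integer over $\mathbb{A}_p$; (ii) $|\alpha_1|_p>1$; (iii) $|\alpha_i|_p\le 1$ for all other non-archimedean conjugates, $i=2,\dots,n$; (iv) $|\alpha_i|_\infty<1$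 for all archimedean conjugates, $i=n+1,\dots,2n$. A Salem-Chabauty (SC) number is defined in the same way with (iv) replaced by (iv)' $|\alpha_i|_\infty=1$ for all archimedean conjugates, $i=n+1,\dots,2n$. Integer and fractional part: each $x\in\mathbb{Q}_p$ is uniquely $x=\sum_{i\ge n_0}x_ip^i$ with $x_i\in\{0,\dots,p-1\}$; put $\lfloor x\rfloor_p:=\sum_{i\ge0}x_ip^i\in\mathbb{Z}_p$ and $\{x\}_p:=\sum_{i<0}x_ip^i\in\mathbb{A}_p\cap[0,1)$. Beta-expansion: for $\beta\in\mathbb{Q}_p$ with $|\beta|_p>1$ let $T:\mathbb{Z}_p\to\mathbb{Z}_p$, $T(x)=\lfloor\beta x\rfloor_p$. For $\alpha\in\mathbb{Z}_p$ the beta-expansion $d_\beta(\alpha)$ is the sequence $(d_k)_{k\ge1}$ with $d_k=\{\beta T^{k-1}(\alpha)\}_p$. $\mathrm{Per}(\beta)$ is the set of $\alpha\in\mathbb{Z}_p$ for which $d_\beta(\alpha)$ is eventually periodic. *)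

(* Defs.v *)
From HB Require Import structures.
From mathcomp Require Import all_boot all_order all_algebra.
From mathcomp Require Import all_classical all_reals.
From mathcomp Require Import fraction complex.

Set Implicit Arguments.
Unset Strict Implicit.
Unset Printing Implicit Defensive.

Import Order.TTheory GRing.Theory Num.Theory.
Local Open Scope ring_scope.

(* Z_p as the inverse limit of the rings Z/p^n: an element is the coherent
   sequence of its residues zres n in [0, p^n).  The primality proof is an index
   of the type because Z_p is an integral domain only for p prime. *)
Record padic_int (p : nat) (p_pr : prime p) := PadicInt {
  zres :> nat -> nat;
  zresP : forall n, (zres n.+1 %% p ^ n)%N = zres n }.

Section PadicIntRing.
Local Open Scope nat_scope.
Variables (p : nat) (p_pr : prime p).
Local Notation Zp := (padic_int p_pr).
Implicit Types x y z : Zp.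

Lemma padic_int_inj x y : (forall n, x n = y n) -> x = y.
Proof.
case: x y => [x xP] [y yP] /= /funext exy; move: xP yP; rewrite {}exy => xP yP.
by congr PadicInt; apply: Prop_irrelevance.
Qed.

Lemma zres_mod x n : x n %% p ^ n = x n.
Proof. by rewrite -zresP modn_mod. Qed.

Lemma zres_lt x n : x n < p ^ n.
Proof. by rewrite -zres_mod ltn_mod expn_gt0 prime_gt0. Qed.

Lemma zres_modle x m n : m <= n -> x n %% p ^ m = x m.
Proof.
move=> /subnK <-; elim: (n - m) => [|k IHk]; first exact: zres_mod.
by rewrite -IHk -(zresP x (k + m)) modn_dvdm // dvdn_exp2l // leq_addl.
Qed.

Lemma expn_modS (a n : nat) : a %% p ^ n.+1 %% p ^ n = a %% p ^ n.
Proof. by rewrite modn_dvdm // dvdn_exp2l. Qed.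

Fact zadd_subproof x y n :
  (x n.+1 + y n.+1) %% p ^ n.+1 %% p ^ n = (x n + y n) %% p ^ n.
Proof. by rewrite expn_modS -modnDm !zresP. Qed.
Definition zadd x y : Zp := PadicInt p_pr (zadd_subproof x y).

Fact zmul_subproof x y n :
  (x n.+1 * y n.+1) %% p ^ n.+1 %% p ^ n = (x n * y n) %% p ^ n.
Proof. by rewrite expn_modS -modnMm !zresP. Qed.
Definition zmul x y : Zp := PadicInt p_pr (zmul_subproof x y).

Fact zopp_subproof x n :
  (p ^ n.+1 - x n.+1) %% p ^ n.+1 %% p ^ n = (p ^ n - x n) %% p ^ n.
Proof.
rewrite expn_modS; apply/eqP; rewrite -(eqn_modDr (x n)) subnK ?(ltnW (zres_lt _ _)) //.
by rewrite -(zresP x n) modnDmr subnK ?(ltnW (zres_lt _ _)) // expnS modnMl modnn.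
Qed.
Definition zopp x : Zp := PadicInt p_pr (zopp_subproof x).

Fact znat_subproof (k n : nat) : k %% p ^ n.+1 %% p ^ n = k %% p ^ n.
Proof. exact: expn_modS. Qed.
Definition znat k : Zp := PadicInt p_pr (znat_subproof k).

Lemma zaddA : associative zadd.
Proof.
by move=> x y z; apply: padic_int_inj => n /=; rewrite modnDml modnDmr addnA.
Qed.
Lemma zaddC : commutative zadd.
Proof. by move=> x y; apply: padic_int_inj => n /=; rewrite addnC. Qed.
Lemma zadd0 : left_id (znat 0) zadd.
Proof. by move=> x; apply: padic_int_inj => n /=; rewrite modnDml zres_mod. Qed.
Lemma zaddN : left_inverse (znat 0) zopp zadd.
Proof.
move=> x; apply: padic_int_inj => n /=.
by rewrite modnDml subnK ?(ltnW (zres_lt _ _)) // modnn mod0n.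
Qed.

HB.instance Definition _ := gen_eqMixin Zp.
HB.instance Definition _ := gen_choiceMixin Zp.
HB.instance Definition _ := GRing.isZmodule.Build Zp zaddA zaddC zadd0 zaddN.

Lemma zmulA : associative zmul.
Proof.
by move=> x y z; apply: padic_int_inj => n /=; rewrite modnMml modnMmr mulnA.
Qed.
Lemma zmulC : commutative zmul.
Proof. by move=> x y; apply: padic_int_inj => n /=; rewrite mulnC. Qed.
Lemma zmul1 : left_id (znat 1) zmul.
Proof.
by move=> x; apply: padic_int_inj => n /=; rewrite modnMml mul1n zres_mod.
Qed.
Lemma zmulDl : left_distributive zmul zadd.
Proof.
move=> x y z; apply: padic_int_inj => n /=.
by rewrite modnMml modnDm mulnDl.
Qed.
Lemma zone_neq0 : znat 1 != znat 0.
Proof.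
apply/eqP => /(congr1 (fun x : Zp => x 1)) /=.
by rewrite expn1 mod0n modn_small ?prime_gt1.
Qed.

HB.instance Definition _ :=
  GRing.Zmodule_isComNzRing.Build Zp zmulA zmulC zmul1 zmulDl zone_neq0.

Lemma zres_coprime x n : x 1 != 0 -> coprime (x n) (p ^ n).
Proof.
move=> x1; case: n => [|n]; first by rewrite expn0 coprimen1.
rewrite coprime_pexpr // coprime_sym prime_coprime //; apply: contra x1.
by rewrite -(zres_modle x (ltn0Sn n)) expn1.
Qed.

Definition zinv_res x n := (egcdn (x n) (p ^ n)).1 %% p ^ n.

Lemma zinv_resP x n : x 1 != 0 -> zinv_res x n * x n = 1 %[mod p ^ n].
Proof.
move=> x1; rewrite /zinv_res modnMml.
case: n => [|n]; first by rewrite expn0 !modn1.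
have xn_gt0 : 0 < x n.+1.
  rewrite lt0n; apply: contra x1 => /eqP xn0.
  by rewrite -(zres_modle x (ltn0Sn n)) xn0 mod0n.
case: egcdnP => //= u v e _; rewrite e (eqP (zres_coprime n.+1 x1)).
by rewrite -modnDml modnMl.
Qed.

Fact zinv_subproof x (x1 : x 1 != 0) n :
  zinv_res x n.+1 %% p ^ n = zinv_res x n.
Proof.
have -> : zinv_res x n = zinv_res x n %% p ^ n by rewrite /zinv_res modn_mod.
have h1 := zinv_resP n x1.
have h2 : zinv_res x n.+1 * x n = 1 %[mod p ^ n].
  rewrite -zresP modnMmr -expn_modS zinv_resP // expn_modS; exact: erefl.
rewrite -[LHS]modn_mod -[in LHS](muln1 (zinv_res _ _)).
rewrite modn_mod -modnMmr -h1 modnMmr mulnCA -modnMmr h2 modnMmr muln1.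
by [].
Qed.

Definition zunit : {pred Zp} := [pred x : Zp | x 1 != 0].
Definition zinv x : Zp :=
  match pselect (x 1 != 0) with
  | left x1 => PadicInt p_pr (zinv_subproof x1)
  | right _ => x
  end.

Lemma zmulV : {in zunit, left_inverse 1%R zinv *%R}.
Proof.
move=> x; rewrite inE /zinv => x1; case: pselect => // ?.
by apply: padic_int_inj => n /=; rewrite zinv_resP.
Qed.
Lemma zunitPl x y : (y * x)%R = 1%R -> zunit x.
Proof.
move=> /(congr1 (fun x : Zp => x 1)) /=; rewrite /zunit /= expn1.
rewrite (modn_small (prime_gt1 p_pr)) => yx1; apply/eqP => x0; move: yx1.
by rewrite x0 muln0 mod0n.
Qed.
Lemma zinv_out : {in [predC zunit], zinv =1 id}.
Proof. by move=> x; rewrite !inE /zinv => /negP nx; case: pselect. Qed.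

HB.instance Definition _ :=
  GRing.ComNzRing_hasMulInverse.Build Zp zmulV zunitPl zinv_out.

Lemma znat0P x : reflect (exists n, x n != 0) (x != 0%R).
Proof.
apply: (iffP idP) => [|[n xn]].
  apply: contra_neqP => /forallNP x0; apply: padic_int_inj => n /=.
  by rewrite mod0n; apply/eqP; apply/negPn/negP/x0.
by apply: contra xn => /eqP ->; rewrite /= mod0n.
Qed.

Lemma zres0_dvd x n : (x n == 0) = (p ^ n %| x n).
Proof. by rewrite /dvdn zres_mod. Qed.

Lemma zmul_eq0 x y : (x * y)%R = 0%R -> (x == 0%R) || (y == 0%R).
Proof.
move=> xy0; apply/negPn/negP; rewrite negb_or => /andP[/znat0P[m xm] /znat0P[n yn]].
set k := m + n; have /= := congr1 (fun x : Zp => x k) xy0; rewrite mod0n => /eqP.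
have xk : ~~ (p ^ m %| x k) by rewrite /dvdn zres_modle ?leq_addr.
have yk : ~~ (p ^ n %| y k) by rewrite /dvdn zres_modle ?leq_addl.
have xk0 : 0 < x k by rewrite lt0n; apply: contra xk => /eqP ->.
have yk0 : 0 < y k by rewrite lt0n; apply: contra yk => /eqP ->.
rewrite -/(dvdn _ _) pfactor_dvdn ?muln_gt0 ?xk0 // lognM //.
move: xk yk; rewrite !pfactor_dvdn // -!ltnNge => xk yk.
by apply/negP; rewrite -ltnNge /k -addnS leq_add // ltnW.
Qed.

HB.instance Definition _ := GRing.ComUnitRing_isIntegral.Build Zp zmul_eq0.

Lemma zres_nat k n : (k%:R : Zp)%R n = k %% p ^ n.
Proof.
elim: k => [|k IHk]; first by rewrite /= mod0n.
by rewrite -natr1 /= IHk modnDm addn1.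
Qed.

End PadicIntRing.

Section PadicExpansion.
Local Open Scope nat_scope.
Variables (p : nat) (p_pr : prime p).
Local Notation Zp := (padic_int p_pr).
Implicit Types (x z : Zp) (d : nat -> 'I_p).

Lemma sum_digits_lt d n : \sum_(i < n) d i * p ^ i < p ^ n.
Proof.
elim: n => [|n IHn]; first by rewrite big_ord0 expn0.
rewrite big_ord_recr /= expnS; apply: leq_trans (_ : (d n).+1 * p ^ n <= _).
  by rewrite mulSn ltn_add2r.
by rewrite leq_mul2r ltn_ord orbT.
Qed.

Fact padic_series_subproof d n :
  (\sum_(i < n.+1) d i * p ^ i) %% p ^ n = \sum_(i < n) d i * p ^ i.
Proof.
by rewrite big_ord_recr /= addnC modnMDl modn_small // sum_digits_lt.
Qed.

(* The sum of the series \sum_(i >= 0) d_i p^i. *)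
Definition padic_series d : Zp := PadicInt p_pr (padic_series_subproof d).

Fact padic_digit_subproof z i : z i.+1 %/ p ^ i < p.
Proof. by rewrite ltn_divLR ?expn_gt0 ?prime_gt0 // -expnS zres_lt. Qed.

Definition padic_digit z i : 'I_p := Ordinal (padic_digit_subproof z i).

Lemma padic_digitK z : padic_series (padic_digit z) = z.
Proof.
apply: padic_int_inj => /=; elim=> [|n IHn].
  by rewrite big_ord0 -zres_mod expn0 modn1.
by rewrite big_ord_recr /= IHn -[in z n]zresP addnC -divn_eq.
Qed.

Fact zshift_subproof z v n :
  (z (v + n.+1) %/ p ^ v) %% p ^ n = z (v + n) %/ p ^ v.
Proof.
rewrite -(zresP z (v + n)) -addnS expnD mulnC.
by rewrite modn_divl mulnC.
Qed.
(* The digits of z from index v on. *)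
Definition zshift z v : Zp := PadicInt p_pr (zshift_subproof z v).

Lemma zshiftP z v : z v = 0 -> z = (p%:R ^+ v * zshift z v)%R.
Proof.
move=> zv0; apply: padic_int_inj => n /=.
rewrite -natrX zres_nat modnMml.
have pv : p ^ v %| z (v + n) by rewrite /dvdn zres_modle ?leq_addr // zv0.
by rewrite mulnC divnK // zres_modle // leq_addl.
Qed.

(* The p-adic valuation; by convention 0 at 0. *)
Definition padic_int_val z : nat :=
  match pselect (exists n, z n.+1 != 0) with
  | left e => ex_minn e
  | right _ => 0
  end.

Lemma padic_int_valP z : z != 0%R ->
  z (padic_int_val z) = 0 /\ z (padic_int_val z).+1 != 0.
Proof.
move=> /znat0P[[|n] zn]; first by move: zn; rewrite -zres_mod expn0 modn1.
rewrite /padic_int_val; case: pselect => [e|[]]; last by exists n.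
case: ex_minnP => -[|v] zv vmin; split=> //; first by rewrite -zres_mod expn0 modn1.
by apply/eqP/negPn/negP => /vmin; rewrite ltnn.
Qed.

Lemma padic_int_factor z : z != 0%R ->
  exists2 u : Zp, u \is a GRing.unit & z = (p%:R ^+ padic_int_val z * u)%R.
Proof.
move=> /padic_int_valP; set v := padic_int_val z => -[zv zv1].
exists (zshift z v); last exact: zshiftP.
change (z (v + 1) %/ p ^ v != 0); apply: contra zv1 => /eqP zv1.
rewrite -addn1 (divn_eq (z (v + 1)) (p ^ v)) zv1 mul0n add0n addn1.
by rewrite zresP zv.
Qed.

End PadicExpansion.

(* Q_p, the field of fractions of Z_p. *)
Notation padic p_pr := {fraction (padic_int p_pr)}.
Notation "x %:F" := (@FracField.tofrac _ x) : ring_scope.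

Section PadicField.
Variables (p : nat) (p_pr : prime p).
Local Notation Zp := (padic_int p_pr).
Local Notation Qp := (padic p_pr).
Implicit Types (x : Qp) (z : Zp).

(* padic_normE below: |a / b|_p = p^(v(b) - v(a)) for every fraction a / b. *)
Definition padic_norm (R : realType) x : R :=
  if x == 0 then 0
  else p%:R ^ ((padic_int_val (\d_(repr x)))%:Z
               - (padic_int_val (\n_(repr x)))%:Z).

(* x = \sum_(i >= 0) d_i p^(i - N).  The index N may be larger than necessary:
   the leading digits are then 0. *)
Definition padic_expansion x (N : nat) (d : nat -> 'I_p) : Prop :=
  x = (padic_series p_pr d)%:F / p%:R ^+ N.

Lemma padic_numden x : x = (\n_(repr x))%:F / (\d_(repr x))%:F.
Proof.
have d0 := denom_ratioP (repr x).
apply: (canRL (mulfK _)); first by rewrite tofrac_eq0.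
rewrite -[in LHS](reprK x); unlock FracField.tofrac.
rewrite -[LHS]FracField.pi_mul; apply/eqmodP.
rewrite /= FracField.equivfE /FracField.mulf.
rewrite !numden_Ratio ?mulf_neq0 ?oner_eq0 //.
by rewrite reprK !mulr1 mulrC.
Qed.

Lemma padic_int_val_unique z v : z v = 0%N -> z v.+1 != 0%N -> padic_int_val z = v.
Proof.
move=> zv zv1.
have z0 : z != 0 by apply/znat0P; exists v.+1.
have [zw zw1] := padic_int_valP z0.
apply/eqP; rewrite eqn_leq; apply/andP; split; rewrite leqNgt; apply/negP => h.
- by move: zv1; rewrite -(zres_modle z h) zw mod0n.
- by move: zw1; rewrite -(zres_modle z h) zv mod0n.
Qed.

Lemma padic_int_valMX z v : z \is a GRing.unit -> padic_int_val (p%:R ^+ v * z) = v.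
Proof.
move=> zU; have z1 : z 1%N != 0%N by [].
have pp := prime_gt1 p_pr.
apply: padic_int_val_unique; rewrite -natrX /= zres_nat modnMml.
  by rewrite modnMr.
rewrite expnSr -muln_modr muln_eq0 negb_or expn_eq0.
rewrite -[X in (_ %% X)%N](expn1 p) zres_modle // z1 andbT.
by case: (p) pp => // -[].
Qed.

Lemma padic_int_valM z w : z != 0 -> w != 0 ->
  padic_int_val (z * w) = (padic_int_val z + padic_int_val w)%N.
Proof.
move=> /padic_int_factor[u uU zE] /padic_int_factor[t tU wE].
rewrite [in LHS]zE [in LHS]wE mulrACA -exprD padic_int_valMX //.
by rewrite unitrM uU.
Qed.

Lemma padic_normE (R : realType) (a b : Zp) : a != 0 -> b != 0 ->
  padic_norm R (a%:F / b%:F) = p%:R ^ ((padic_int_val b)%:Z - (padic_int_val a)%:Z).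
Proof.
move=> a0 b0; set x := a%:F / b%:F.
have x0 : x != 0 by rewrite mulf_neq0 ?invr_eq0 ?tofrac_eq0.
rewrite /padic_norm (negPf x0).
have d0 := denom_ratioP (repr x).
have n0 : \n_(repr x) != 0.
  by apply: contra x0 => /eqP n0; rewrite [x]padic_numden n0 tofrac0 mul0r.
have /(congr1 (@padic_int_val _ _)) : \n_(repr x) * b = a * \d_(repr x).
  apply/eqP; rewrite -tofrac_eq !tofracM -eqr_div ?tofrac_eq0 //.
  by rewrite -padic_numden.
rewrite !padic_int_valM // => e; congr (_ ^ _).
by apply/eqP; rewrite subr_eq addrAC eq_sym subr_eq -!PoszD [X in Posz X == _]addnC e addnC.
Qed.

Lemma padic_expansion_ex x :
  exists Nd : nat * (nat -> 'I_p), padic_expansion x Nd.1 Nd.2.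
Proof.
have [u uU bE] := padic_int_factor (denom_ratioP (repr x)).
exists (padic_int_val (\d_(repr x)), padic_digit (\n_(repr x) * u^-1)).
rewrite /padic_expansion /= padic_digitK [LHS]padic_numden [in LHS]bE.
by rewrite !rmorphM rmorphV // rmorphXn rmorph_nat invfM mulrA mulrAC.
Qed.

(* A chosen expansion of x.  Expansions of x differ only in the number of leading
   zeros, so padic_floor and padic_frac do not depend on the choice. *)
Definition padic_index x : nat := (sval (cid (padic_expansion_ex x))).1.
Definition padic_digits x : nat -> 'I_p := (sval (cid (padic_expansion_ex x))).2.

Lemma padic_digitsP x : padic_expansion x (padic_index x) (padic_digits x).
Proof. exact: svalP (cid (padic_expansion_ex x)). Qed.

Definition padic_floor x : Zp :=
  padic_series p_pr (fun i => padic_digits x (padic_index x + i)%N).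

Definition padic_frac x : rat :=
  \sum_(i < padic_index x) (padic_digits x i)%:R * p%:R ^ (i%:Z - (padic_index x)%:Z).

Lemma padic_natr_neq0 n : (0 < n)%N -> n%:R != 0 :> Zp.
Proof.
move=> n0; apply/znat0P; exists n; rewrite zres_nat modn_small -?lt0n //.
exact/ltn_expl/prime_gt1.
Qed.

Lemma padicF_nat n : n%:R = (n%:R : Zp)%:F :> Qp.
Proof. by rewrite rmorph_nat. Qed.

Lemma padicF_natr_neq0 n : (0 < n)%N -> n%:R != 0 :> Qp.
Proof.
move=> /padic_natr_neq0; rewrite -tofrac_eq0; apply: contraNN => /eqP e.
rewrite padicF_nat in e. by rewrite e.
Qed.

Lemma padic_ratr (m d : nat) : (0 < d)%N -> ratr (m%:R / d%:R) = m%:R / d%:R :> Qp.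
Proof.
move=> d0; have Q0 := padicF_natr_neq0.
set q := _ / _; rewrite /ratr.
have q0 : 0 <= q by rewrite divr_ge0 ?ler0n.
have [k kE] : exists k : nat, numq q = k by move: q0; rewrite -numq_ge0; case: numq => // k _; exists k.
have [l [lE l0]] : exists l : nat, denq q = l /\ (0 < l)%N.
  by move: (denq_gt0 q); case: denq => // l l0; exists l.
rewrite kE lE -!pmulrn; apply/eqP; rewrite eqr_div ?Q0 // -!natrM; apply/eqP.
congr (_%:R); apply/eqP; rewrite -(eqr_nat rat) !natrM -eqr_div ?pnatr_eq0 -?lt0n //.
by move: (divq_num_den q); rewrite kE lE -!pmulrn => ->.
Qed.

Lemma padic_floor_frac x : x = (padic_floor x)%:F + ratr (padic_frac x).
Proof.
have p0 := prime_gt0 p_pr.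
have pQ0 : p%:R != 0 :> rat by rewrite pnatr_eq0 -lt0n.
rewrite {1}(padic_digitsP x) /padic_floor /padic_frac.
move: (padic_index x) (padic_digits x) => N d.
have -> : \sum_(i < N) (d i)%:R * p%:R ^ (i%:Z - N%:Z) =
    (\sum_(i < N) d i * p ^ i)%:R / (p ^ N)%:R :> rat.
  rewrite natr_sum mulr_suml; apply: eq_bigr => i _.
  by rewrite natrM !natrX -mulrA expfzDr // exprnN.
rewrite padic_ratr ?expn_gt0 ?p0 // natrX.
have pF0 : p%:R ^+ N != 0 :> Qp.
  by rewrite -natrX padicF_natr_neq0 ?expn_gt0 ?p0.
apply: (mulIf pF0); rewrite mulrDl !divfK //.
rewrite -natrX !padicF_nat -tofracM -tofracD.
congr (_%:F); apply: padic_int_inj => n.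
rewrite /= !zres_nat modnMmr modnDm big_distrl /=.
have -> : (\sum_(i < n) d (N + i)%N * p ^ i * p ^ N + \sum_(i < N) d i * p ^ i
   = \sum_(i < n + N) d i * p ^ i)%N.
  rewrite addnC (addnC n N) big_split_ord /=; congr (_ + _)%N.
  by apply: eq_bigr => i _; rewrite -mulnA -expnD (addnC i).
exact: esym (zres_modle (padic_series p_pr d) (leq_addr N n)).
Qed.

End PadicField.

(* A_p = Z[1/p]. *)
Definition inA (p : nat) : {pred rat} :=
  [pred q : rat | `[< exists m n : int, q = m%:~R * p%:R ^ n >]].

Definition Apoly_unit (p : nat) (P : {poly rat}) : Prop :=
  exists2 Q, Q \is a polyOver (inA p) & P * Q = 1.

(* P is an irreducible element of the ring A_p[X]. *)
Definition Apoly_irreducible (p : nat) (P : {poly rat}) : Prop :=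
  [/\ P \is a polyOver (inA p), P != 0, ~ Apoly_unit p P &
      forall Q1 Q2, Q1 \is a polyOver (inA p) -> Q2 \is a polyOver (inA p) ->
        P = Q1 * Q2 -> Apoly_unit p Q1 \/ Apoly_unit p Q2].

(* By Gauss's lemma alpha has at most one such polynomial: its minimal polynomial
   over A_p.  It exists iff alpha is an algebraic integer over A_p. *)
Definition Amin_poly (p : nat) (p_pr : prime p) (alpha : padic p_pr)
    (P : {poly rat}) : Prop :=
  [/\ P \is monic, Apoly_irreducible p P & root (map_poly ratr P) alpha].

(* L is algebraically closed by its type. *)
Definition algebraic_closure (F : fieldType) (L : closedFieldType)
    (iota : {rmorphism F -> L}) : Prop :=
  forall z : L, algebraicOver iota z.

(* nrm is the (unique) extension of |.|_p to L. *)
Record extends_padic_norm (p : nat) (p_pr : prime p) (R : realType)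
    (L : fieldType) (iota : {rmorphism padic p_pr -> L}) (nrm : L -> R) : Prop := {
  ext_normE : forall x, nrm (iota x) = padic_norm R x;
  ext_norm_ge0 : forall z, 0 <= nrm z;
  ext_norm_eq0 : forall z, nrm z = 0 -> z = 0;
  ext_normM : {morph nrm : z w / z * w};
  ext_normD : forall z w, nrm (z + w) <= Num.max (nrm z) (nrm w) }.

Section PisotSalem.
Variables (p : nat) (p_pr : prime p) (R : realType) (L : closedFieldType).
Variables (iota : {rmorphism padic p_pr -> L}) (nrm : L -> R).

(* The minimal polynomial P has rational coefficients; its roots in L are the
   non-archimedean conjugates and its roots in R[i] the archimedean ones.  P is
   separable, so the conjugates other than alpha are the roots different from it. *)
Definition PC_number (alpha : padic p_pr) : Prop :=
  exists P, [/\ Amin_poly alpha P,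
    1 < padic_norm R alpha,
    forall z : L, root (map_poly ratr P) z -> z != iota alpha -> nrm z <= 1 &
    forall z : R[i], root (map_poly ratr P) z -> `|z| < 1].

Definition SC_number (alpha : padic p_pr) : Prop :=
  exists P, [/\ Amin_poly alpha P,
    1 < padic_norm R alpha,
    forall z : L, root (map_poly ratr P) z -> z != iota alpha -> nrm z <= 1 &
    forall z : R[i], root (map_poly ratr P) z -> `|z| = 1].

End PisotSalem.

Definition eventually_periodic (T : Type) (u : nat -> T) : Prop :=
  exists N l : nat, (0 < l)%N /\ forall n, (N <= n)%N -> u (n + l)%N = u n.

Section BetaExpansion.
Variables (p : nat) (p_pr : prime p) (beta : padic p_pr).
Local Notation Zp := (padic_int p_pr).

Definition beta_map (x : Zp) : Zp := padic_floor (beta * x%:F).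

(* Indexed from 0: beta_digit alpha k is the digit d_(k+1). *)
Definition beta_digit (alpha : Zp) (k : nat) : rat :=
  padic_frac (beta * (iter k beta_map alpha)%:F).

Definition Per : set Zp :=
  [set alpha | eventually_periodic (beta_digit alpha)]%classic.

End BetaExpansion.

(* Main.v *)
(* Write T^k n = P_k(beta) with P_0 = n and P_(k+1) = X P_k - d_(k+1).  Digit
   sequences separate points, so if d_beta(n) is eventually periodic then
   P_(N+l) - P_N vanishes at beta for some N and l > 0.

   For n = 1 this polynomial Q is monic over A_p with coefficients of norm at
   most |beta|_p; Gauss's lemma puts the minimal polynomial of beta over A_p,
   and the cofactor W in Q = (X - beta) W has coefficients in the unit ball, so its
   roots satisfy |z|_p <= 1.

   If z in C is a conjugate with g = |z| > 1, then P_(N+l)(z) = P_N(z) and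
   0 <= d_k < 1 give (n (g - 1) - 1)(g - 1) <= 2 for every n in S, which is
   impossible since S is unbounded.  So all complex conjugates lie in the closed
   unit disc, and if one lies on the unit circle the minimal polynomial is
   self-reciprocal, so that all of them do. *)
Require Import Defs.
From HB Require Import structures.
From mathcomp Require Import all_boot all_order all_algebra.
From mathcomp Require Import all_classical all_reals.
From mathcomp Require Import fraction complex.

Set Implicit Arguments.
Unset Strict Implicit.
Unset Printing Implicit Defensive.

Import Order.TTheory GRing.Theory Num.Theory.
Local Open Scope classical_set_scope.
Local Open Scope ring_scope.

(** * The embedding of $\mathbb{Q}$ in a field of characteristic zero *)

Section RatrCharZero.
Variable F : fieldType.
Hypothesis F0 : forall n, (0 < n)%N -> n%:R != 0 :> F.

Lemma char0_intr_eq0 (m : int) : (m%:~R == 0 :> F) = (m == 0).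
Proof.
case: m => [[|n]|n]; first by rewrite mulr0z !eqxx.
  by rewrite -pmulrn (negPf (F0 _)).
by rewrite NegzE mulrNz oppr_eq0 -pmulrn (negPf (F0 _)).
Qed.

Lemma char0_ratr_frac (m d : int) : d != 0 ->
  ratr (m%:~R / d%:~R) = m%:~R / d%:~R :> F.
Proof.
move=> d0; rewrite /ratr; set q := _ / _.
apply/eqP; rewrite eqr_div ?char0_intr_eq0 ?denq_neq0 // -!intrM; apply/eqP.
congr (_%:~R); apply: (@intr_inj rat); rewrite !intrM; apply/eqP.
by rewrite -eqr_div ?intr_eq0 ?denq_neq0 // divq_num_den.
Qed.

Fact char0_ratr_zmod_morphism : zmod_morphism (@ratr F).
Proof.
move=> x y; rewrite -[in LHS](divq_num_den x) -[in LHS](divq_num_den y).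
have dx := denq_neq0 x; have dy := denq_neq0 y.
rewrite -mulNr addf_div ?intr_eq0 // -mulrNz -!intrM -intrD.
rewrite char0_ratr_frac ?mulf_neq0 // intrD !intrM mulrNz.
by rewrite -addf_div ?char0_intr_eq0 // mulNr.
Qed.

Fact char0_ratr_monoid_morphism : monoid_morphism (@ratr F).
Proof.
split=> [|x y]; first by rewrite (ratr_int F 1).
rewrite -[in LHS](divq_num_den x) -[in LHS](divq_num_den y) mulf_div -!intrM.
by rewrite char0_ratr_frac ?mulf_neq0 ?denq_neq0 // !intrM -mulf_div.
Qed.

(** The proof of characteristic zero is an argument so that the morphism instances below can attach
    to this alias of [ratr] for any such field, ordered or not; they serve $\mathbb{Q}_p$. *)
Definition char0_ratr of (forall n, (0 < n)%N -> n%:R != 0 :> F) : rat -> F :=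
  @ratr F.

HB.instance Definition _ := GRing.isZmodMorphism.Build rat F (char0_ratr F0)
  char0_ratr_zmod_morphism.
HB.instance Definition _ := GRing.isMonoidMorphism.Build rat F (char0_ratr F0)
  char0_ratr_monoid_morphism.

End RatrCharZero.

Definition padic_ratr (p : nat) (p_pr : prime p) : {rmorphism rat -> padic p_pr} :=
  char0_ratr (@padicF_natr_neq0 p p_pr).

(** * Minimal polynomials over $\mathbb{Q}$ *)

Section RationalAnnihilators.
Variables (F : fieldType) (f : {rmorphism rat -> F}) (b : F).

Definition is_rat_minpoly (P : {poly rat}) : Prop :=
  [/\ P \is monic, root (map_poly f P) b &
      forall Q, root (map_poly f Q) b -> P %| Q].

Lemma rat_minpoly_ex (Q : {poly rat}) : Q != 0 -> root (map_poly f Q) b ->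
  exists P, is_rat_minpoly P.
Proof.
move=> Q0 Qb.
pose ann n := `[< exists P, [/\ P != 0, root (map_poly f P) b & size P = n] >].
have ex_ann : exists n, ann n by exists (size Q); apply/asboolP; exists Q.
case: (ex_minnP ex_ann) => n /asboolP[P [P0 Pb szP]] minP.
have lP0 : lead_coef P != 0 by rewrite lead_coef_eq0.
exists ((lead_coef P)^-1 *: P); split.
- by rewrite monicE lead_coefZ mulVf.
- by rewrite map_polyZ rootZ // fmorph_eq0 invr_eq0.
move=> Q' Q'b; rewrite dvdpZl ?invr_eq0 // /dvdp.
(* A nonzero remainder would be an annihilator smaller than $P$. *)
apply/negPn/negP => r0.
have /minP : ann (size (Q' %% P)).
  apply/asboolP; exists (Q' %% P); split=> //.
  move: Q'b; rewrite [in X in X -> _](divp_eq Q' P) rmorphD rmorphM /= /root hornerD hornerM.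
  by rewrite (rootP Pb) mulr0 add0r.
by rewrite leqNgt -szP ltn_modp P0.
Qed.

Lemma rat_minpoly_irreducible P : is_rat_minpoly P -> irreducible_poly P.
Proof.
move=> [Pm Pb Pmin]; have P0 := monic_neq0 Pm.
have sz_gt1 : (1 < size P)%N.
  by rewrite -(size_map_poly f); apply: root_size_gt1 Pb; rewrite map_poly_eq0.
split=> // Q szQ /dvdpP[W PE].
have QP : Q %| P by rewrite PE dvdp_mull.
have : root (map_poly f W * map_poly f Q) b by rewrite -rmorphM -PE.
rewrite rootM => /orP[/Pmin PW | /Pmin PQ]; last exact/andP.
have W0 : W != 0 by apply: contra_neq P0 => W0; rewrite PE W0 mul0r.
have Q0 : Q != 0 by apply: contra_neq P0 => Q0; rewrite PE Q0 mulr0.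
(* Were $P$ to divide [W], comparing sizes in $P = WQ$ would force [Q] to be constant. *)
have := dvdp_leq W0 PW; rewrite PE size_mul //.
have : (1 < size Q)%N by rewrite ltn_neqAle eq_sym szQ lt0n size_poly_eq0.
case: (size Q) => [|[|s]] // _; by rewrite !addnS /= ltnNge leq_addr.
Qed.

End RationalAnnihilators.

(** * Factorisation over $\mathbb{A}_p$ *)

Section ApolyIrreducibility.
Variable (p : nat).
Hypothesis p_pr : prime p.

Let p0 : p%:R != 0 :> rat.
Proof. by rewrite pnatr_eq0 -lt0n prime_gt0. Qed.

Lemma inAP (q : rat) :
  reflect (exists (m : int) (k : nat), p%:R ^+ k * q = m%:~R) (q \in inA p).
Proof.
apply: (iffP (asboolP _)) => [[m [n ->]]|[m [k e]]].
  case: n => n; last by exists m, n.+1; rewrite NegzE -exprnN mulrC divfK // expf_neq0.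
  exists (m * p%:R ^+ n), 0%N; by rewrite expr0 mul1r rmorphM rmorphXn /= mulrz_nat.
exists m, (- k%:Z); by rewrite -e -exprnN mulrC mulKf // expf_neq0.
Qed.

Fact inA_subring_closed : subring_closed (inA p).
Proof.
split.
- by apply/inAP; exists 1, 0%N; rewrite mulr1.
- move=> x y /inAP[m [k ex]] /inAP[m' [k' ey]]; apply/inAP.
  exists (p%:R ^+ k' * m - p%:R ^+ k * m'), (k + k')%N.
  rewrite rmorphB !rmorphM !rmorphXn /= !mulrz_nat -ex -ey exprD.
  by rewrite mulrBr -!mulrA; congr (_ - _); rewrite mulrCA.
- move=> x y /inAP[m [k ex]] /inAP[m' [k' ey]]; apply/inAP.
  by exists (m * m'), (k + k')%N; rewrite intrM -ex -ey exprD mulrACA.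
Qed.
HB.instance Definition _ := GRing.isSubringClosed.Build rat (inA p) inA_subring_closed.

Lemma inA_intr (m : int) : m%:~R \in inA p.
Proof. by apply: rpred_int. Qed.

Lemma inA_divX (m : int) k : m%:~R / p%:R ^+ k \in inA p.
Proof. by apply/inAP; exists m, k; rewrite mulrC divfK // expf_neq0. Qed.

Lemma Apoly_clear_denom (Q : {poly rat}) : Q \is a polyOver (inA p) ->
  exists (k : nat) (Q' : {poly int}), p%:R ^+ k *: Q = map_poly intr Q'.
Proof.
elim/poly_ind: Q => [|Q c IHQ] QA.
  by exists 0%N, 0; rewrite scaler0 map_poly0.
have [|k [Q' QE]] := IHQ.
  by apply/polyOverP => i; have /(polyOverP)/(_ i.+1) := QA; rewrite coefD coefMX coefC addr0.
have /polyOverP/(_ 0%N) := QA; rewrite coefD coefMX coefC add0r /= => /inAP[m [l e]].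
exists (k + l)%N, (p%:R ^+ l *: Q' * 'X + (p%:R ^+ k * m)%:P).
rewrite rmorphD rmorphM /= map_polyZ map_polyX map_polyC /= -QE intrM -e.
rewrite !rmorphXn /= !mulrz_nat scalerDr scalerAl scalerA -exprD.
by rewrite mulrA -exprD -mul_polyC -polyCM addnC.
Qed.

(** Gauss's lemma over $\mathbb{Z}$ gives $P = aP_1$ and $p^kQ = P_1r$ with $P_1, r$ integral.
    Comparing leading coefficients, $a\,\mathrm{lc}(P_1)=1$ and
    $\mathrm{lc}(P_1)\,\mathrm{lc}(r)=p^k$, so $a=\mathrm{lc}(r)/p^k$ lies in $\mathbb{A}_p$. *)
Lemma inA_monic_divisor (P Q : {poly rat}) :
  P \is monic -> Q \is monic -> Q \is a polyOver (inA p) -> P %| Q ->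
  P \is a polyOver (inA p).
Proof.
move=> Pm Qm QA PQ; have [k [Q' QE]] := Apoly_clear_denom QA.
have : P %| map_poly intr Q' by rewrite -QE dvdpZr ?expf_neq0.
move=> /dvdpP_rat_int[P1 [a a0 PE]] [r Q'E].
have aE : a * (lead_coef P1)%:~R = 1.
  by rewrite -[RHS](monicP Pm) PE lead_coefZ (lead_coef_map_inj (@intr_inj rat)) ?mulr0z.
have lE : (lead_coef P1)%:~R * (lead_coef r)%:~R = p%:R ^+ k :> rat.
  rewrite -intrM -lead_coefM -Q'E.
  by rewrite -[RHS]mulr1 -[X in _ = _ * X](monicP Qm) -lead_coefZ QE (lead_coef_map_inj (@intr_inj rat)) ?mulr0z.
have aA : a \in inA p.
  have -> : a = (lead_coef r)%:~R / p%:R ^+ k.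
    by apply: (canRL (mulfK _)); rewrite ?expf_neq0 // -lE mulrA aE mul1r.
  exact: inA_divX.
apply/polyOverP => i; rewrite PE coefZ coef_map /= rpredM // inA_intr //.
Qed.

(** In a factorisation over $\mathbb{A}_p$, irreducibility over $\mathbb{Q}$ makes one factor
    constant. As the product is monic, the inverse of that constant is the leading coefficient of
    the other factor, which lies in $\mathbb{A}_p$. *)
Lemma irreducible_Apoly (P : {poly rat}) : P \is monic ->
  P \is a polyOver (inA p) -> irreducible_poly P -> Apoly_irreducible p P.
Proof.
move=> Pm PA [szP Pirr]; have P0 := monic_neq0 Pm.
have unitC (Q W : {poly rat}) : W \is a polyOver (inA p) -> Q * W \is monic -> size Q = 1%N ->
    Apoly_unit p Q.
  move=> WA QWm /eqP/size_poly1P[c c0 QE]; exists (lead_coef W)%:P.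
    by rewrite polyOverC (polyOverP WA).
  rewrite QE -polyCM; move: QWm; rewrite QE mul_polyC monicE lead_coefZ => /eqP ->.
  by [].
split=> //.
  move=> [Q _ PQ1]; have := congr1 (fun q : {poly rat} => size q) PQ1.
  have Q0 : Q != 0 by apply: contra_eq_neq PQ1 => ->; rewrite mulr0 eq_sym oner_eq0.
  rewrite size_mul // size_poly1; move: szP; rewrite -size_poly_gt0 in Q0.
  by case: (size P) (size Q) Q0 => [|[|n]] // [|m] // _ _; rewrite addnS.
move=> Q1 Q2 Q1A Q2A PE.
have [s1|s1] := eqVneq (size Q1) 1%N; first by left; apply: unitC Q2A _ s1; rewrite -PE.
right; apply: unitC Q1A _ _; first by rewrite mulrC -PE.
have Q1P : Q1 %= P by apply: Pirr => //; rewrite PE dvdp_mulr.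
have Q10 : Q1 != 0 by apply: contra_neq P0 => Q0; rewrite PE Q0 mul0r.
have Q20 : Q2 != 0 by apply: contra_neq P0 => Q0; rewrite PE Q0 mulr0.
move: (eqp_size Q1P); rewrite PE size_mul //; move: Q10 Q20; rewrite -!size_poly_gt0.
case: (size Q1) (size Q2) => [|n] // [|m] // _ _; rewrite addnS /= addSn => -[] /eqP.
by rewrite -[X in X == _]addn0 eqn_add2l => /eqP <-.
Qed.

End ApolyIrreducibility.

(** * The orbit polynomials $P_k$, with digits indexed from 0 *)

Fixpoint orbit_poly (a : rat) (d : nat -> rat) (k : nat) : {poly rat} :=
  if k is j.+1 then 'X * orbit_poly a d j - (d j)%:P else a%:P.

Section OrbitPoly.
Variables (a : rat) (d : nat -> rat).

(** [S] is abstract for the sake of two uses: $\mathbb{A}_p$ yields integrality, a $p$-adic ball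
    yields the coefficient bound. *)
Lemma coef_orbit_polyB (S : {pred rat}) : a \in S -> (forall j, d j \in S) ->
  {in S &, forall x y, x - y \in S} ->
  forall k l i, (orbit_poly a d k - orbit_poly a d l)`_i \in S.
Proof.
move=> Sa Sd SB.
have S0 : 0 \in S by rewrite -(subrr a) SB.
suff PS k i : (orbit_poly a d k)`_i \in S by move=> k l i; rewrite coefB SB.
elim: k i => [|k IHk] i /=; first by rewrite coefC; case: ifP.
by rewrite coefB coefXM coefC SB //; case: ifP.
Qed.

Lemma size_orbit_poly_le k : (size (orbit_poly a d k) <= k.+1)%N.
Proof.
elim: k => [|k IHk] /=; first exact: size_polyC_leq1.
apply: leq_trans (size_polyD _ _) _; rewrite size_polyN geq_max.
rewrite (leq_trans (size_polyC_leq1 _)) // andbT mulrC.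
have [->|P0] := eqVneq (orbit_poly a d k) 0; first by rewrite mul0r size_poly0.
by rewrite size_mulX.
Qed.

(** This is what $1\in S$ is for: $P_k$ has leading term $aX^k$, and $P_N$ has smaller degree than
    $P_{N+l}$. *)
Lemma orbit_polyB_monic N l : a = 1 -> (0 < l)%N ->
  orbit_poly a d (N + l) - orbit_poly a d N \is monic.
Proof.
move=> a1 l0.
have lead1 k : (orbit_poly a d k)`_k = 1.
  by elim: k => [|k IHk] /=; rewrite ?coefC // coefB coefXM coefC /= subr0.
have ltN : (size (orbit_poly a d N) <= N + l)%N.
  by rewrite (leq_trans (size_orbit_poly_le N)) // -addn1 leq_add2l.
have szNl : size (orbit_poly a d (N + l)) = (N + l).+1.
  apply/eqP; rewrite eqn_leq size_orbit_poly_le ltnNge; apply/negP => /leq_sizeP.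
  by move=> /(_ (N + l)%N (leqnn _)) /eqP; rewrite lead1 oner_eq0.
rewrite monicE lead_coefDl ?size_polyN ?szNl //.
by rewrite lead_coefE szNl /= lead1.
Qed.

Lemma horner_orbit_polyS (F : fieldType) (f : {rmorphism rat -> F}) z k :
  (map_poly f (orbit_poly a d k.+1)).[z] =
  z * (map_poly f (orbit_poly a d k)).[z] - f (d k).
Proof.
by rewrite /= rmorphB rmorphM /= map_polyX map_polyC /= !hornerE mulrC.
Qed.

End OrbitPoly.

(** * The estimate at complex conjugates *)

Section ArchimedeanBound.
Variables (K : numFieldType) (a : nat) (d : nat -> rat) (z : K).
Hypothesis d01 : forall k, 0 <= d k < 1.
Hypothesis z_gt1 : 1 < `|z|.
Local Notation ev k := (map_poly ratr (orbit_poly a%:R d k)).[z].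

(** Unfolded, the error is $-\sum_{j<k}d_jz^{k-1-j}$, at most the geometric sum $(|z|^k-1)/(|z|-1)$
    in modulus; the factor $|z|-1$ clears the denominator. *)
Lemma orbit_poly_error k :
  `|ev k - a%:R * z ^+ k| * (`|z| - 1) <= `|z| ^+ k - 1.
Proof.
elim: k => [|k IHk].
  by rewrite /= map_polyC hornerC /= rmorph_nat !expr0 mulr1 !subrr normr0 mul0r.
have -> : ev k.+1 - a%:R * z ^+ k.+1 = z * (ev k - a%:R * z ^+ k) - ratr (d k).
  by rewrite horner_orbit_polyS mulrBr exprS (mulrCA z) addrAC.
have nd : `|ratr (d k) : K| <= 1.
  have /andP[d0 d1] := d01 k; rewrite ger0_norm ?ler0q //.
  by rewrite -[leRHS](rmorph1 (@ratr K)) ler_rat ltW.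
have g1 : 0 <= `|z| - 1 by rewrite subr_ge0 ltW.
apply: le_trans (ler_wpM2r g1 (ler_normB _ _)) _.
rewrite normrM mulrDl -mulrA.
apply: le_trans (lerD (ler_wpM2l (normr_ge0 z) IHk) (ler_wpM2r g1 nd)) _.
by rewrite mul1r mulrBr mulr1 -exprS addrA subrK.
Qed.

Lemma orbit_poly_bound N l : (0 < l)%N -> ev (N + l) = ev N ->
  (a%:R * (`|z| - 1) - 1) * (`|z| - 1) <= 2%:R.
Proof.
move=> l0 evE; set g := `|z|.
have g1 : 0 < g - 1 by rewrite subr_gt0.
have g0 : 0 < g by apply: lt_trans z_gt1.
(* As the two values agree, $az^{N+l}-az^N$ is a difference of two errors. Their bounds $g^N-1$ and
   $g^{N+l}-1$ add up to at most $g^N(g^l+1)$, and $g^N$ cancels. *)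
have h : a%:R * (g ^+ l - 1) * (g - 1) <= g ^+ l + 1.
  rewrite -(ler_pM2l (exprn_gt0 N g0)).
  apply: (@le_trans _ _ (`|a%:R * z ^+ (N + l) - a%:R * z ^+ N| * (g - 1))).
    rewrite mulrA (ler_pM2r g1) -mulrBr normrM normr_nat mulrCA.
    by rewrite ler_wpM2l ?ler0n // mulrBr mulr1 -exprD /g -!normrX lerB_dist.
  have -> : a%:R * z ^+ (N + l) - a%:R * z ^+ N =
      (ev N - a%:R * z ^+ N) - (ev (N + l) - a%:R * z ^+ (N + l)).
    by rewrite evE opprB [RHS]addrC subrKA.
  apply: le_trans (ler_wpM2r (ltW g1) (ler_normB _ _)) _.
  rewrite mulrDl; apply: le_trans (lerD (orbit_poly_error _) (orbit_poly_error _)) _.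
  rewrite mulrDr mulr1 -exprD addrC lerD // lerBlDr lerDl //.
(* Rewritten as $(a(g-1)-1)(g^l-1)\le2$, [h] becomes independent of $l$ through this bound when the
   first factor is nonnegative; otherwise the claim is trivial. *)
have gl : g - 1 <= g ^+ l - 1 by rewrite lerB // ler_eXnr // ltW.
(* The order of a [numFieldType] is partial: the case split on the sign requires a real element. *)
have tR : a%:R * (g - 1) - 1 \is Num.real.
  by rewrite realB ?real1 // realM ?realn // gtr0_real.
have [c|/ltW c] := real_leP tR (real0 _).
  by rewrite (le_trans _ (ler0n _ 2)) // mulr_le0_ge0 // ltW.
apply: le_trans (ler_wpM2l c gl) _.
rewrite mulrBl mul1r lerBlDr mulrAC (le_trans h) //.
by rewrite addrCA -[2%:R]/(1 + 1) addrK.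
Qed.

End ArchimedeanBound.

(** * Roots of polynomials under an ultrametric norm *)

Section NonArchimedean.
Variables (p : nat) (p_pr : prime p) (R : realType) (L : fieldType).
Variables (iota : {rmorphism padic p_pr -> L}) (nrm : L -> R).
Hypothesis nrm_ext : extends_padic_norm iota nrm.
Implicit Types z w : L.

Let nrm_ge0 z : 0 <= nrm z.
Proof. exact: ext_norm_ge0 nrm_ext z. Qed.

Lemma ext_norm0 : nrm 0 = 0.
Proof. by rewrite -(rmorph0 iota) (ext_normE nrm_ext) /padic_norm eqxx. Qed.

Lemma ext_norm_gt0 z : z != 0 -> 0 < nrm z.
Proof.
by move=> z0; rewrite lt_neqAle nrm_ge0 andbT eq_sym; apply: contra_neq z0 => /(ext_norm_eq0 nrm_ext).
Qed.

Lemma ext_norm1 : nrm 1 = 1.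
Proof.
have n1 : nrm 1 != 0 by rewrite gt_eqF // ext_norm_gt0 ?oner_eq0.
by apply: (mulfI n1); rewrite -(ext_normM nrm_ext) !mulr1.
Qed.

Lemma ext_normN z : nrm (- z) = nrm z.
Proof.
suff n1 : nrm (- 1) = 1 by rewrite -mulN1r (ext_normM nrm_ext) n1 mul1r.
apply/eqP; rewrite -(@eqrXn2 _ 2) ?ler01 // expr1n expr2 -(ext_normM nrm_ext).
by rewrite mulrNN mulr1 ext_norm1.
Qed.

Lemma ext_normB_le z w c : nrm z <= c -> nrm w <= c -> nrm (z - w) <= c.
Proof.
move=> zc wc; apply: le_trans (ext_normD nrm_ext _ _) _.
by rewrite ge_max zc ext_normN wc.
Qed.

Lemma ext_normX z k : nrm (z ^+ k) = nrm z ^+ k.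
Proof.
by elim: k => [|k IHk]; rewrite ?expr0 ?ext_norm1 // !exprS (ext_normM nrm_ext) IHk.
Qed.

Lemma ext_norm_padic_int (x : padic_int p_pr) : nrm (iota x%:F) <= 1.
Proof.
have [->|x0] := eqVneq x 0; first by rewrite !rmorph0 ext_norm0 ler01.
have -> : x%:F = x%:F / 1%:F by rewrite rmorph1 divr1.
rewrite (ext_normE nrm_ext) padic_normE ?oner_eq0 //.
have -> : padic_int_val (1 : padic_int p_pr) = 0%N.
  have := @padic_int_valMX _ p_pr 1 0 (unitr1 _); by rewrite expr0 mulr1.
rewrite sub0r -exprnN invf_le1 ?exprn_gt0 ?ltr0n ?prime_gt0 //.
by rewrite exprn_ege1 // ler1n prime_gt0.
Qed.

(* Comparing coefficients in (X - b) W = Q from the constant term upwards gives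
   b W_i = W_(i-1) - Q_i. *)
Lemma ext_norm_quotient_coef (W : {poly L}) b c : 1 <= nrm b ->
  (forall i, nrm (W * ('X - b%:P))`_i <= c) -> forall i, nrm W`_i <= c / nrm b.
Proof.
move=> b1 Qc; have b0 : 0 < nrm b := lt_le_trans ltr01 b1.
have c0 : 0 <= c := le_trans (nrm_ge0 _) (Qc 0%N).
elim=> [|i IHi]; rewrite ler_pdivlMr // -(ext_normM nrm_ext).
  by have := Qc 0%N; rewrite mulrBr coefB coefMX coefMC sub0r ext_normN.
have -> : W`_i.+1 * b = W`_i - (W * ('X - b%:P))`_i.+1.
  by rewrite mulrBr coefB coefMX coefMC /= subKr.
apply: ext_normB_le => //; apply: le_trans IHi _.
by rewrite ler_pdivrMr // ler_peMr.
Qed.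

(** Dividing $Q$ by $X-b$ leaves $W$ with coefficients of norm at most 1. If $|z|>1$, dividing $W$
    by $X-z$ leaves a monic $V$ with coefficients of norm at most $1/|z|<1$, which its leading
    coefficient contradicts. *)
Lemma ext_norm_other_root (Q : {poly L}) b z : Q \is monic -> 1 < nrm b ->
  (forall i, nrm Q`_i <= nrm b) -> root Q b -> root Q z -> z != b -> nrm z <= 1.
Proof.
move=> Qm b1 Qc /factor_theorem[W QE] Qz zb; rewrite leNgt; apply/negP => z1.
have W1 i : nrm W`_i <= 1.
  rewrite -(divff (lt0r_neq0 (lt_trans ltr01 b1))).
  by apply: ext_norm_quotient_coef (ltW b1) _ i => j; rewrite -QE.
have /factor_theorem[V WE] : root W z.
  by move: Qz; rewrite QE rootM root_XsubC (negPf zb) orbF.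
have Vm : V \is monic.
  by move: Qm; rewrite QE WE !monicMr ?monicXsubC.
have Vc i : nrm V`_i <= 1 / nrm z.
  by apply: ext_norm_quotient_coef (ltW z1) _ i => j; rewrite -WE.
have := Vc (size V).-1; rewrite -lead_coefE (monicP Vm) ext_norm1 div1r leNgt.
by rewrite invf_lt1 ?z1 // (lt_trans ltr01).
Qed.

End NonArchimedean.

(** * Orbits of the beta-map *)

Lemma exprn_unbounded (R : realType) (g C : R) : 1 < g -> exists k, C < g ^+ k.
Proof.
move=> g1; have h0 : 0 < g - 1 by rewrite subr_gt0.
exists (Num.bound `|C / (g - 1)|).
set k := Num.bound _; have : C / (g - 1) < k%:R.
  by apply: le_lt_trans (ler_norm _) (archi_boundP (normr_ge0 _)).
rewrite ltr_pdivrMr // => /lt_le_trans; apply.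
(* A form of Bernoulli's inequality: $k(g-1)\le g^k$. *)
elim: k => [|k IHk]; first by rewrite mul0r expr0 ler01.
rewrite -natr1 mulrDl mul1r exprS; apply: le_trans (lerD IHk (lexx _)) _.
by rewrite -lerBrDl -[X in _ <= _ - X]mul1r -mulrBl ler_peMr ?exprn_ege1 // ltW.
Qed.

Section BetaOrbit.
Variables (p : nat) (p_pr : prime p) (R : realType) (L : fieldType).
Variables (iota : {rmorphism padic p_pr -> L}) (nrm : L -> R).
Hypothesis nrm_ext : extends_padic_norm iota nrm.
Variable beta : padic p_pr.
Hypothesis beta_gt1 : 1 < nrm (iota beta).
Local Notation Zp := (padic_int p_pr).
Local Notation T := (beta_map beta).
Implicit Types x y : Zp.

Lemma padic_fracE (u : padic p_pr) : exists2 m : nat,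
  (m < p ^ padic_index u)%N & padic_frac u = m%:R / p%:R ^+ padic_index u.
Proof.
exists (\sum_(i < padic_index u) padic_digits u i * p ^ i)%N.
  exact: sum_digits_lt.
rewrite /padic_frac natr_sum mulr_suml; apply: eq_bigr => i _.
have p0 : p%:R != 0 :> rat by rewrite pnatr_eq0 -lt0n prime_gt0.
by rewrite natrM natrX -mulrA expfzDr // exprnN.
Qed.

Lemma padic_frac_itv (u : padic p_pr) : 0 <= padic_frac u < 1.
Proof.
have [m mlt ->] := padic_fracE u.
have p0 : 0 < p%:R ^+ padic_index u :> rat by rewrite exprn_gt0 // ltr0n prime_gt0.
by rewrite divr_ge0 ?ler0n ?(ltW p0) //= ltr_pdivrMr // mul1r -natrX ltr_nat.
Qed.

Lemma padic_frac_inA (u : padic p_pr) : padic_frac u \in inA p.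
Proof. by have [m _ ->] := padic_fracE u; apply: (inA_divX p_pr m). Qed.

Lemma beta_map_step x :
  (T x)%:F = beta * x%:F - padic_ratr p_pr (padic_frac (beta * x%:F)).
Proof. by rewrite [X in X - _]padic_floor_frac addrK. Qed.

Lemma beta_digit_iter x m k : beta_digit beta (iter m T x) k = beta_digit beta x (k + m).
Proof. by rewrite /beta_digit iterD. Qed.

(** A digit equals $\beta y-T(y)$ with $y,T(y)\in\mathbb{Z}_p$, and $|\beta|_p>1$. *)
Lemma beta_digit_norm x k :
  nrm (iota (padic_ratr p_pr (beta_digit beta x k))) <= nrm (iota beta).
Proof.
rewrite /beta_digit; set y := iter k T x.
have -> : padic_ratr p_pr (padic_frac (beta * y%:F)) = beta * y%:F - (T y)%:F.
  by rewrite beta_map_step subKr.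
rewrite rmorphB; apply: (ext_normB_le nrm_ext).
  rewrite rmorphM (ext_normM nrm_ext) ler_piMr ?(ext_norm_ge0 nrm_ext) //.
  exact: ext_norm_padic_int.
by apply: le_trans (ext_norm_padic_int nrm_ext _) (ltW beta_gt1).
Qed.

(** A coincidence in the orbit of [n] thus becomes an equation for $\beta$ with rational
    coefficients, which can be transported to $\mathbb{C}$. *)
Lemma horner_orbit_poly (n k : nat) :
  (map_poly (padic_ratr p_pr)
     (orbit_poly n%:R (beta_digit beta (n%:R : Zp)) k)).[beta]
  = (iter k T (n%:R : Zp))%:F.
Proof.
elim: k => [|k IHk]; first by rewrite /= map_polyC hornerC /= !rmorph_nat.
by rewrite horner_orbit_polyS IHk iterS beta_map_step.
Qed.

(* Equal digits give T^k x - T^k y = beta^k (x - y), and the left-hand side is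
   bounded. *)
Lemma beta_digit_inj x y : beta_digit beta x =1 beta_digit beta y -> x = y.
Proof.
move=> exy.
have step k : (iter k T x)%:F - (iter k T y)%:F = beta ^+ k * (x%:F - y%:F).
  elim: k => [|k IHk]; first by rewrite mul1r.
  rewrite !iterS !beta_map_step; move: (exy k); rewrite /beta_digit => ->.
  by rewrite opprB addrA subrK -mulrBr IHk exprS mulrA.
apply/eqP; rewrite -subr_eq0 -tofrac_eq0 rmorphB /=.
apply/negPn/negP => xy0; have := xy0; rewrite -(fmorph_eq0 iota) => /(ext_norm_gt0 nrm_ext) n0.
have [k] := exprn_unbounded (nrm (iota (x%:F - y%:F)))^-1 beta_gt1.
apply/negP; rewrite -leNgt -[leRHS]mul1r ler_pdivlMr // -(ext_normX nrm_ext).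
rewrite -(ext_normM nrm_ext) -rmorphXn -rmorphM -step rmorphB.
by apply: (ext_normB_le nrm_ext); apply: ext_norm_padic_int.
Qed.

(** The two iterates have as digit sequences the tails of $d_\beta(x)$ from $N+l$ and from $N$,
    which agree by periodicity. *)
Lemma Per_iter x : Per beta x ->
  exists N l : nat, (0 < l)%N /\ iter (N + l) T x = iter N T x.
Proof.
move=> [N [l [l0 per]]]; exists N, l; split=> //.
apply: beta_digit_inj => k; rewrite !beta_digit_iter addnA; apply: per.
exact: leq_addl.
Qed.

End BetaOrbit.

(** * Conjugates on the unit circle *)

Section CircleRoots.
Variables (K : numClosedFieldType) (P : {poly rat}).
Hypothesis P_irr : irreducible_poly P.
Local Notation PK := (map_poly (ratr : rat -> K) P).
Implicit Types z w : K.

Definition reverse_poly : {poly rat} := \poly_(i < size P) P`_((size P).-1 - i).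

Lemma horner_reverse_poly z : z != 0 ->
  (map_poly ratr reverse_poly).[z] = z ^+ (size P).-1 * PK.[z^-1].
Proof.
move=> z0; have P0 : (0 < size P)%N by rewrite size_poly_gt0 irredp_neq0.
rewrite (@horner_coef_wide _ (size P)); last first.
  by rewrite size_map_poly size_poly.
rewrite horner_coef size_map_poly mulr_sumr (reindex_inj rev_ord_inj) /=.
apply: eq_bigr => i _; rewrite !coef_map coef_poly /= ltn_subrL P0 /=.
have ile : (i <= (size P).-1)%N by rewrite -ltnS prednK ?ltn_ord.
have -> : (size P - i.+1 = (size P).-1 - i)%N by rewrite -subn1 -subnDA add1n.
by rewrite subKn // mulrCA exprB ?unitfE // exprVn.
Qed.

(** The gcd of $P$ and $Q$ vanishes at [z], so it is not constant and is associate to $P$. *)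
Lemma irreducible_dvdp_root (Q : {poly rat}) z :
  root PK z -> root (map_poly ratr Q) z -> P %| Q.
Proof.
move=> Pz Qz; have [_ Pirr] := P_irr.
have gz : root (map_poly (ratr : rat -> K) (gcdp P Q)) z.
  by rewrite gcdp_map root_gcd Pz.
have /eqp_dvdl <- : gcdp P Q %= P; last exact: dvdp_gcdr.
apply: Pirr; last exact: dvdp_gcdl.
apply: contraTneq gz => /eqP/size_poly1P[c c0 ->].
by rewrite map_polyC rootC /= fmorph_eq0.
Qed.

(* A root z on the unit circle has z^-1 = z^*, which is also a root, so P
   divides its reciprocal polynomial. *)
Lemma circle_root_inv z w :
  root PK z -> `|z| = 1 -> root PK w -> w != 0 /\ root PK w^-1.
Proof.
move=> Pz z1 Pw; have P0 : P != 0 := irredp_neq0 P_irr.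
have z0 : z != 0 by rewrite -normr_gt0 z1.
have conjPK : map_poly Num.conj PK = PK.
  rewrite -map_poly_comp; apply: eq_map_poly => a /=.
  exact: (fmorph_eq_rat (Num.conj \o ratr : {rmorphism rat -> K})).
have Pzi : root PK z^-1.
  by rewrite invC_norm z1 expr1n invr1 mul1r -conjPK fmorph_root.
have Qz : root (map_poly ratr reverse_poly) z.
  by rewrite /root horner_reverse_poly // (rootP Pzi) mulr0.
have Qw : root (map_poly (ratr : rat -> K) reverse_poly) w.
  have /dvdpP[V ->] := irreducible_dvdp_root Pz Qz.
  by rewrite rmorphM rootM Pw orbT.
have w0 : w != 0.
  apply: contraTneq Qw => ->; rewrite /root horner_coef0 coef_map fmorph_eq0.
  by rewrite coef_poly size_poly_gt0 P0 subn0 -lead_coefE lead_coef_eq0.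
split=> //; move: Qw; rewrite /root horner_reverse_poly //.
by rewrite mulf_eq0 expf_eq0 (negPf w0) andbF.
Qed.

End CircleRoots.

(** * Letting $n$ grow in $S$, and the conclusion *)

Lemma infinite_nat_unbounded (S : set nat) (B : nat) :
  infinite_set S -> exists2 n, S n & (B < n)%N.
Proof.
move=> Sinf; apply: contrapT => noS; apply: Sinf.
apply: (@sub_finite_set _ _ `I_B.+1); last exact: finite_II.
by move=> n Sn /=; rewrite ltnS leqNgt; apply/negP => Bn; apply: noS; exists n.
Qed.

Lemma bounded_multiples_le1 (R : realType) (S : set nat) (g : R) :
  infinite_set S ->
  (forall n, S n -> 1 < g -> (n%:R * (g - 1) - 1) * (g - 1) <= 2%:R) -> g <= 1.
Proof.
move=> Sinf Sg; rewrite leNgt; apply/negP => g1.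
have h0 : 0 < g - 1 by rewrite subr_gt0.
(* The bound on [n] obtained by solving the assumed inequality for it. *)
set C := (2%:R / (g - 1) + 1) / (g - 1).
have [n Sn Bn] := infinite_nat_unbounded (Num.bound `|C|) Sinf.
have := Sg n Sn g1; rewrite -ler_pdivlMr // lerBlDr -ler_pdivlMr // leNgt.
apply/negP; rewrite negbK; apply: le_lt_trans (ler_norm _) _.
apply: lt_trans (archi_boundP (normr_ge0 _)) _.
by rewrite ltr_nat.
Qed.

Theorem theorem4p4 (R : realType) (p : nat) (p_pr : prime p)
  (L : closedFieldType) (iota : {rmorphism padic p_pr -> L}) (nrm : L -> R)
  (L_closure : algebraic_closure iota)
  (nrm_ext : extends_padic_norm iota nrm)
  (beta : padic p_pr) (beta_gt1 : 1 < padic_norm R beta)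
  (S : set nat) (S_inf : infinite_set S) (S_gt0 : forall n, S n -> (0 < n)%N)
  (S1 : S 1%N)
  (S_Per : [set (n%:R : padic_int p_pr) | n in S] `<=` Per beta) :
  PC_number iota nrm beta \/ SC_number iota nrm beta.
Proof.
have beta_gt1' : 1 < nrm (iota beta) by rewrite (ext_normE nrm_ext).
pose f := padic_ratr p_pr.
pose d n := beta_digit beta (n%:R : padic_int p_pr).
have ann n : S n -> exists N l, (0 < l)%N /\
    root (map_poly f (orbit_poly n%:R (d n) (N + l) - orbit_poly n%:R (d n) N)) beta.
  move=> Sn; have /(Per_iter nrm_ext beta_gt1')[N [l [l0 TE]]] : Per beta (n%:R : padic_int p_pr).
    by apply: S_Per; exists n.
  exists N, l; split=> //; rewrite /root rmorphB hornerD hornerN.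
  by rewrite !horner_orbit_poly TE subrr.
have [N1 [l1 [l1_gt0 Qbeta]]] := ann 1%N S1.
set Q := _ - _ in Qbeta.
have Qm : Q \is monic by apply: orbit_polyB_monic.
have [P Pmin] := rat_minpoly_ex (monic_neq0 Qm) Qbeta.
have [Pm Pbeta Pdvd] := Pmin.
have Pirr := rat_minpoly_irreducible Pmin.
have QA : Q \is a polyOver (inA p).
  have [A1 AB _] := inA_subring_closed p_pr.
  apply/(all_nthP 0) => i _; apply: coef_orbit_polyB => // j.
  exact: padic_frac_inA.
have PA := inA_monic_divisor p_pr Pm Qm QA (Pdvd _ Qbeta).
have Amin : Amin_poly beta P.
  by split=> //; apply: irreducible_Apoly.
(* Ring morphisms out of $\mathbb{Q}$ are unique, so passing through $\mathbb{Q}_p$ does not change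
   the roots in [L]. *)
have Lratr : iota \o f =1 ratr by apply: (fmorph_eq_rat (iota \o f : {rmorphism rat -> L})).
have PL z : root (map_poly ratr P) z -> z != iota beta -> nrm z <= 1.
  (* The coefficient bound is known for $Q$ and not for $P$; the roots of $P$ are among those of
     $Q$. *)
  move=> Pz zb; apply: (ext_norm_other_root nrm_ext (Q := map_poly (iota \o f) Q)) zb => //.
  - by rewrite map_monic.
  - move=> i; rewrite coef_map.
    pose S' := [pred c : rat | nrm (iota (f c)) <= nrm (iota beta)].
    apply: (coef_orbit_polyB (S := S')) => [|j|x y Sx Sy]; rewrite inE.
    + by rewrite (rmorph1 f) (rmorph1 iota) (ext_norm1 nrm_ext) ltW.
    + exact: beta_digit_norm.
    + by rewrite (rmorphB f) (rmorphB iota); apply: (ext_normB_le nrm_ext Sx Sy).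
  - have -> := map_poly_comp iota f Q.
    by rewrite (fmorph_root iota); exact: Qbeta.
  - have /dvdpP[W ->] := Pdvd _ Qbeta.
    have Pz' : root (map_poly (iota \o f) P) z by rewrite (eq_map_poly Lratr).
    by rewrite rmorphM rootM; apply/orP; right.
have PC_le1 (z : R[i]) : root (map_poly ratr P) z -> `|z| <= 1.
  (* The modulus in [R[i]] is itself an element of [R[i]]; [g] is the real number it comes from. *)
  move=> Pz; have [g gE] : exists g : R, `|z| = g%:C%C by eexists; exact: normc_def.
  rewrite gE lecR; apply: bounded_multiples_le1 S_inf _ => n Sn g1.
  (* Each [n] has its own annihilator of $\beta$, but $P$ divides them all, so each of them vanishes
     at [z]. *)
  have [N [l [l0 /Pdvd/dvdpP[W WE]]]] := ann n Sn.
  have d01 k : 0 <= d n k < 1 by apply: padic_frac_itv.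
  have z1 : 1 < `|z| by rewrite gE ltcR.
  have evE : (map_poly ratr (orbit_poly n%:R (d n) (N + l))).[z] =
             (map_poly ratr (orbit_poly n%:R (d n) N)).[z].
    apply/eqP; rewrite -subr_eq0 -hornerN -hornerD -rmorphB WE rmorphM hornerM.
    by rewrite (rootP Pz) mulr0.
  have := orbit_poly_bound d01 z1 l0 evE; rewrite gE.
  by rewrite -lecR !(rmorphM, rmorphB, rmorph_nat, rmorph1).
have [[z0 Pz0 z01]|no1] := pselect (exists2 z : R[i], root (map_poly ratr P) z & `|z| = 1).
  right; exists P; split=> // z Pz.
  (* The inverse of [z] is also a conjugate; the disc bound for it gives $|z|\ge1$. *)
  have [z_neq0 /PC_le1] := circle_root_inv Pirr Pz0 z01 Pz.
  rewrite normfV invf_le1 ?normr_gt0 // => z_ge1.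
  by apply/eqP; rewrite eq_le PC_le1.
left; exists P; split=> // z Pz; rewrite lt_neqAle PC_le1 // andbT.
by apply/eqP => z1; apply: no1; exists z.
Qed.
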